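(* Let $\mathcal C$ be a $\Bbbk$-linear pivotal category, $\mathcal M$ and $\mathcal N$ ($\Bbbk$-linear) right $\mathcal C$-module categories, $\mathcal F\colon\mathcal M\to\mathcal N$ a ($\Bbbk$-linear) $\mathcal C$-module functor, and $\mathsf t^{\mathcal N}$ a right module trace on $\mathcal N$ (with identity endofunctor). Then the family of maps $$\mathsf t^{\mathcal M}_M(f):=\mathsf t^{\mathcal N}_{\mathcal F(M)}\bigl(\mathcal F(f)\bigr),\qquad M\in\mathcal M,\ f\in\mathrm{End}_{\mathcal M}(M),$$ defines a right module trace on $\mathcal M$ (with identity endofunctor).
   Context: A right $\mathcal C$-module category is a category $\mathcal M$ with an action functor $\odot\colon\mathcal M\times\mathcal C\to\mathcal M$ ($\Bbbk$-bilinear) and natural associativity and unit isomorphisms $(M\odot C)\odot D\cong M\odot(C\otimes D)$, $M\odot\mathbb 1\cong M$ satisfying the usual pentagon and triangle axioms. A $\mathcal C$-module functor $\mathcal F$ is a functor with natural isomorphisms $\sigma_{M,C}\colon\mathcal F(M\odot C)\to\mathcal F(M)\odot C$ compatible with associativity and unit constraints. In the pivotal category $\mathcal C$, each $V$ has a dual $V^*$ with $\mathrm{coev}_V\colon\mathbb 1\to V\otimes V^*$ and right evaluation $\widetilde{\mathrm{ev}}_V\colon V\otimes V^*\to\mathbb 1$ (and the remaining left/right duality maps). A right module trace on $\mathcal M$ (with identity endofunctor) is a family of $\Bbbk$-linear maps $\{\mathsf t_M\colon\mathrm{End}_{\mathcal M}(M)\to\Bbbk\}_{M\in\mathcal M}$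 such that (1) $\mathsf t_M(f\circ g)=\mathsf t_N(g\circ f)$ for all $g\colon M\to N$, $f\colon N\to M$; (2) $\mathsf t_{P\odot V}(f)=\mathsf t_P(\mathrm{tr}^r_V(f))$ for all $P\in\mathcal M$, $V\in\mathcal C$, $f\in\mathrm{End}(P\odot V)$, where $\mathrm{tr}^r_V(f)=(\mathrm{id}_P\odot\widetilde{\mathrm{ev}}_V)\circ(f\odot\mathrm{id}_{V^*})\circ(\mathrm{id}_P\odot\mathrm{coev}_V)$ (module associativity and unit isomorphisms suppressed). *)

(* Defs.v *)
From mathcomp Require Import all_boot all_algebra.

Set Implicit Arguments.
Unset Strict Implicit.
Unset Printing Implicit Defensive.

Import GRing.Theory.
Local Open Scope ring_scope.

Declare Scope lincat_scope.
Delimit Scope lincat_scope with LC.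
Local Open Scope lincat_scope.

Reserved Notation "g \c f" (at level 50, left associativity).
Reserved Notation "X \ot Y" (at level 40, left associativity).
Reserved Notation "f \otm g" (at level 40, left associativity).
Reserved Notation "M \act X" (at level 40, left associativity).
Reserved Notation "f \actm g" (at level 40, left associativity).

Record linCat (k : fieldType) := LinCat {
  obj :> Type;
  mor : obj -> obj -> lmodType k;
  idm : forall X, mor X X;
  comp : forall X Y Z, mor Y Z -> mor X Y -> mor X Z;
  comp_idl : forall X Y (f : mor X Y), comp (idm Y) f = f;
  comp_idr : forall X Y (f : mor X Y), comp f (idm X) = f;
  comp_assoc : forall W X Y Z (h : mor Y Z) (g : mor X Y) (f : mor W X),
    comp h (comp g f) = comp (comp h g) f;
  comp_linear_r : forall X Y Z (g : mor Y Z), linear (fun f : mor X Y => comp g f);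
  comp_linear_l : forall X Y Z (f : mor X Y), linear (fun g : mor Y Z => comp g f)
}.
Arguments mor {k} C X Y : rename.
Arguments idm {k C} X : rename.
Arguments comp {k C X Y Z} g f : rename.
Notation "g \c f" := (comp g f) : lincat_scope.

Record iso (k : fieldType) (C : linCat k) (X Y : C) := Iso {
  iso_hom :> mor C X Y;
  iso_inv : mor C Y X;
  iso_homK : iso_inv \c iso_hom = idm X;
  iso_invK : iso_hom \c iso_inv = idm Y
}.
Arguments iso_inv {k C X Y} i.

Record linFunctor (k : fieldType) (C D : linCat k) := LinFunctor {
  fobj :> C -> D;
  fmap : forall X Y, mor C X Y -> mor D (fobj X) (fobj Y);
  fmap_id : forall X, fmap (idm X) = idm (fobj X);
  fmap_comp : forall X Y Z (g : mor C Y Z) (f : mor C X Y),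
    fmap (g \c f) = fmap g \c fmap f;
  fmap_linear : forall X Y, linear (@fmap X Y)
}.
Arguments fmap {k C D} F {X Y} f : rename.

Record bilinFunctor (k : fieldType) (C D E : linCat k) := BilinFunctor {
  bobj :> C -> D -> E;
  bmap : forall X X' Y Y',
    mor C X X' -> mor D Y Y' -> mor E (bobj X Y) (bobj X' Y');
  bmap_id : forall X Y, bmap (idm X) (idm Y) = idm (bobj X Y);
  bmap_comp : forall X X' X'' Y Y' Y'' (f' : mor C X' X'') (f : mor C X X')
      (g' : mor D Y' Y'') (g : mor D Y Y'),
    bmap (f' \c f) (g' \c g) = bmap f' g' \c bmap f g;
  bmap_linear_l : forall X X' Y Y' (g : mor D Y Y'),
    linear (fun f : mor C X X' => bmap f g);
  bmap_linear_r : forall X X' Y Y' (f : mor C X X'),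
    linear (fun g : mor D Y Y' => bmap f g)
}.
Arguments bmap {k C D E} B {X X' Y Y'} f g : rename.

Record monCat (k : fieldType) := MonCat {
  mon_cat :> linCat k;
  tens : bilinFunctor mon_cat mon_cat mon_cat;
  unit_ob : mon_cat;
  assoc : forall X Y Z : mon_cat, iso (tens (tens X Y) Z) (tens X (tens Y Z));
  lunit : forall X : mon_cat, iso (tens unit_ob X) X;
  runit : forall X : mon_cat, iso (tens X unit_ob) X;
  assoc_nat : forall (X X' Y Y' Z Z' : mon_cat)
      (f : mor mon_cat X X') (g : mor mon_cat Y Y') (h : mor mon_cat Z Z'),
    assoc X' Y' Z' \c bmap tens (bmap tens f g) h
      = bmap tens f (bmap tens g h) \c assoc X Y Z;
  lunit_nat : forall (X X' : mon_cat) (f : mor mon_cat X X'),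
    lunit X' \c bmap tens (idm unit_ob) f = f \c lunit X;
  runit_nat : forall (X X' : mon_cat) (f : mor mon_cat X X'),
    runit X' \c bmap tens f (idm unit_ob) = f \c runit X;
  mon_pentagon : forall W X Y Z : mon_cat,
    assoc W X (tens Y Z) \c assoc (tens W X) Y Z
      = bmap tens (idm W) (assoc X Y Z) \c assoc W (tens X Y) Z
          \c bmap tens (assoc W X Y) (idm Z);
  mon_triangle : forall X Y : mon_cat,
    bmap tens (idm X) (lunit Y) \c assoc X unit_ob Y
      = bmap tens (runit X) (idm Y)
}.
Arguments unit_ob {k C} : rename.
Arguments assoc {k C} X Y Z : rename.
Arguments lunit {k C} X : rename.
Arguments runit {k C} X : rename.
Notation "X \ot Y" := (tens _ X Y) : lincat_scope.
Notation "f \otm g" := (bmap (tens _) f g) : lincat_scope.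

(* Left duality (ev, coev) and right duality (evr, coevr) on the same family of
   dual objects. *)
Record dualities (k : fieldType) (C : monCat k) := Dualities {
  dual : C -> C;
  ev : forall V, mor C (dual V \ot V) unit_ob;
  coev : forall V, mor C unit_ob (V \ot dual V);
  evr : forall V, mor C (V \ot dual V) unit_ob;
  coevr : forall V, mor C unit_ob (dual V \ot V);
  zigzag_ev : forall V,
    runit V \c (idm V \otm ev V) \c assoc V (dual V) V
      \c (coev V \otm idm V) \c iso_inv (lunit V) = idm V;
  zigzag_ev_dual : forall V,
    lunit (dual V) \c (ev V \otm idm (dual V)) \c iso_inv (assoc (dual V) V (dual V))
      \c (idm (dual V) \otm coev V) \c iso_inv (runit (dual V)) = idm (dual V);
  zigzag_evr : forall V,
    lunit V \c (evr V \otm idm V) \c iso_inv (assoc V (dual V) V)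
      \c (idm V \otm coevr V) \c iso_inv (runit V) = idm V;
  zigzag_evr_dual : forall V,
    runit (dual V) \c (idm (dual V) \otm evr V) \c assoc (dual V) V (dual V)
      \c (coevr V \otm idm (dual V)) \c iso_inv (lunit (dual V)) = idm (dual V)
}.
Arguments dual {k C} d V.
Arguments ev {k C} d V.
Arguments coev {k C} d V.
Arguments evr {k C} d V.
Arguments coevr {k C} d V.

Section DualityFunctors.
Variables (k : fieldType) (C : monCat k) (d : dualities C).

(* The morphism X -> V^* corresponding to a pairing, for either duality. *)
Definition lcurry (X V : C) (p : mor C (X \ot V) unit_ob) : mor C X (dual d V) :=
  lunit (dual d V) \c (p \otm idm (dual d V)) \c iso_inv (assoc X V (dual d V))
    \c (idm X \otm coev d V) \c iso_inv (runit X).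

Definition rcurry (X V : C) (p : mor C (V \ot X) unit_ob) : mor C X (dual d V) :=
  runit (dual d V) \c (idm (dual d V) \otm p) \c assoc (dual d V) V X
    \c (coevr d V \otm idm X) \c iso_inv (lunit X).

Definition ldual_map (V W : C) (f : mor C V W) : mor C (dual d W) (dual d V) :=
  lcurry (ev d W \c (idm (dual d W) \otm f)).

Definition rdual_map (V W : C) (f : mor C V W) : mor C (dual d W) (dual d V) :=
  rcurry (evr d W \c (f \otm idm (dual d W))).

(* Monoidal constraints W^* \ot V^* -> (V \ot W)^* and 1 -> 1^* of the two
   contravariant duality functors. *)
Definition ldual_tens (V W : C) : mor C (dual d W \ot dual d V) (dual d (V \ot W)) :=
  lcurry (ev d W
    \c (idm (dual d W) \otm
         (lunit W \c (ev d V \otm idm W) \c iso_inv (assoc (dual d V) V W)))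
    \c assoc (dual d W) (dual d V) (V \ot W)).

Definition rdual_tens (V W : C) : mor C (dual d W \ot dual d V) (dual d (V \ot W)) :=
  rcurry (evr d V
    \c (idm V \otm
         (lunit (dual d V) \c (evr d W \otm idm (dual d V))
            \c iso_inv (assoc W (dual d W) (dual d V))))
    \c assoc V W (dual d W \ot dual d V)).

Definition ldual_unit : mor C unit_ob (dual d unit_ob) := lcurry (runit unit_ob).

Definition rdual_unit : mor C unit_ob (dual d unit_ob) := rcurry (lunit unit_ob).

End DualityFunctors.

(* Pivotal: the left and right duality functors coincide as monoidal functors. *)
Record pivCat (k : fieldType) := PivCat {
  piv_mon :> monCat k;
  piv_dual : dualities piv_mon;
  piv_map : forall (V W : piv_mon) (f : mor piv_mon V W),
    ldual_map piv_dual f = rdual_map piv_dual f;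
  piv_tens : forall V W : piv_mon, ldual_tens piv_dual V W = rdual_tens piv_dual V W;
  piv_unit : ldual_unit piv_dual = rdual_unit piv_dual
}.

Record rmodCat (k : fieldType) (C : monCat k) := RmodCat {
  rmod_cat :> linCat k;
  act : bilinFunctor rmod_cat C rmod_cat;
  act_assoc : forall (M : rmod_cat) (X Y : C),
    iso (act (act M X) Y) (act M (X \ot Y));
  act_unit : forall M : rmod_cat, iso (act M unit_ob) M;
  act_assoc_nat : forall (M M' : rmod_cat) (X X' Y Y' : C)
      (f : mor rmod_cat M M') (g : mor C X X') (h : mor C Y Y'),
    act_assoc M' X' Y' \c bmap act (bmap act f g) h
      = bmap act f (g \otm h) \c act_assoc M X Y;
  act_unit_nat : forall (M M' : rmod_cat) (f : mor rmod_cat M M'),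
    act_unit M' \c bmap act f (idm unit_ob) = f \c act_unit M;
  act_pentagon : forall (M : rmod_cat) (X Y Z : C),
    act_assoc M X (Y \ot Z) \c act_assoc (act M X) Y Z
      = bmap act (idm M) (assoc X Y Z) \c act_assoc M (X \ot Y) Z
          \c bmap act (act_assoc M X Y) (idm Z);
  act_triangle : forall (M : rmod_cat) (X : C),
    bmap act (idm M) (lunit X) \c act_assoc M unit_ob X
      = bmap act (act_unit M) (idm X)
}.
Arguments act {k C} M : rename.
Arguments act_assoc {k C M} P X Y : rename.
Arguments act_unit {k C M} P : rename.
Notation "M \act X" := (act _ M X) : lincat_scope.
Notation "f \actm g" := (bmap (act _) f g) : lincat_scope.

Record modFunctor (k : fieldType) (C : monCat k) (M N : rmodCat C) := ModFunctor {
  mod_fun :> linFunctor M N;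
  mod_str : forall (P : M) (X : C), iso (mod_fun (P \act X)) (mod_fun P \act X);
  mod_str_nat : forall (P P' : M) (X X' : C) (f : mor M P P') (g : mor C X X'),
    mod_str P' X' \c fmap mod_fun (f \actm g)
      = (fmap mod_fun f \actm g) \c mod_str P X;
  mod_str_assoc : forall (P : M) (X Y : C),
    act_assoc (mod_fun P) X Y \c (mod_str P X \actm idm Y) \c mod_str (P \act X) Y
      = mod_str P (X \ot Y) \c fmap mod_fun (act_assoc P X Y);
  mod_str_unit : forall P : M,
    act_unit (mod_fun P) \c mod_str P unit_ob = fmap mod_fun (act_unit P)
}.

Definition ptrace (k : fieldType) (C : pivCat k) (M : rmodCat C) (P : M) (V : C)
    (f : mor M (P \act V) (P \act V)) : mor M P P :=
  let V' := dual (piv_dual C) V in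
  act_unit P
    \c (idm P \actm evr (piv_dual C) V)
    \c act_assoc P V V'
    \c (f \actm idm V')
    \c iso_inv (act_assoc P V V')
    \c (idm P \actm coev (piv_dual C) V)
    \c iso_inv (act_unit P).

Record rmodTrace (k : fieldType) (C : pivCat k) (M : rmodCat C)
    (t : forall P : M, mor M P P -> k) : Prop := RmodTrace {
  rmodTrace_linear : forall P : M, scalar (t P);
  rmodTrace_cyclic : forall (P Q : M) (g : mor M P Q) (f : mor M Q P),
    t P (f \c g) = t Q (g \c f);
  rmodTrace_ptrace : forall (P : M) (V : C) (f : mor M (P \act V) (P \act V)),
    t (P \act V) f = t P (ptrace f)
}.

(* Main.v *)
Require Import Defs.
From mathcomp Require Import all_boot all_algebra.

Set Implicit Arguments.
Unset Strict Implicit.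
Unset Printing Implicit Defensive.

Local Open Scope lincat_scope.

(** Let [s] denote the module structure of [F], so that
    [s_(P,V) : F (P \act V) -> F P \act V].  By cyclicity, the value of the new
    trace at [f : P \act V -> P \act V] is [tN] at the conjugate
    [s \c F f \c s^-1], an endomorphism of [F P \act V], and the partial trace
    property of [tN] turns it into [tN] at the partial trace of that conjugate.
    So everything rests on the fact that a module functor preserves partial
    traces ([fmap_ptrace]): [F (ptrace f) = ptrace (s \c F f \c s^-1)].

    To see this, write [ptrace f] as its seven factors.  Each factor [h], once
    mapped by [F], sits in a commutative square over the corresponding factor in
    the target category, the vertical sides being built from [s]: the squares
    for the unit and associativity constraints are the two coherence axioms of a
    module functor, those for [evr] and [coev] are naturality of [s], and the one
    for [f] is naturality of [s] together with the definition of the conjugate.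
    The vertical sides match, and the two outermost are identities because the
    partial trace starts and ends at [P]; pasting the squares gives the claim. *)

Lemma square_paste (k : fieldType) (C : linCat k) (X Y Z X' Y' Z' : C)
    (p : mor C X X') (q : mor C Y Y') (r : mor C Z Z')
    (g : mor C Y Z) (g' : mor C Y' Z') (f : mor C X Y) (f' : mor C X' Y') :
  r \c g = g' \c q -> q \c f = f' \c p -> r \c (g \c f) = (g' \c f') \c p.
Proof. by move=> sq_g sq_f; rewrite comp_assoc sq_g -!comp_assoc sq_f. Qed.

Lemma square_inv (k : fieldType) (C : linCat k) (X Y X' Y' : C)
    (p : mor C X X') (q : mor C Y Y') (i : iso X Y) (i' : iso X' Y') :
  q \c i = i' \c p -> p \c iso_inv i = iso_inv i' \c q.
Proof.
move=> sq_i; rewrite -[p]comp_idl -(iso_homK i') -(comp_assoc _ _ p) -sq_i.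
by rewrite -!comp_assoc iso_invK comp_idr.
Qed.

Definition fmap_iso (k : fieldType) (C D : linCat k) (F : linFunctor C D)
    (X Y : C) (i : iso X Y) : iso (F X) (F Y).
Proof.
exists (fmap F i) (fmap F (iso_inv i)).
- by rewrite -fmap_comp iso_homK fmap_id.
- by rewrite -fmap_comp iso_invK fmap_id.
Defined.

Definition iso_conj (k : fieldType) (C : linCat k) (X Y : C) (i : iso X Y)
    (f : mor C X X) : mor C Y Y :=
  i \c f \c iso_inv i.

Lemma iso_conj_square (k : fieldType) (C : linCat k) (X Y : C) (i : iso X Y)
    (f : mor C X X) :
  i \c f = iso_conj i f \c i.
Proof. by rewrite /iso_conj -!comp_assoc iso_homK comp_idr. Qed.

Lemma rmodTrace_conj (k : fieldType) (C : pivCat k) (M : rmodCat C)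
    (t : forall P : M, mor M P P -> k) (ht : rmodTrace t) (P Q : M)
    (i : iso P Q) (f : mor M P P) :
  t Q (iso_conj i f) = t P f.
Proof.
by rewrite /iso_conj (rmodTrace_cyclic ht) comp_assoc iso_homK comp_idl.
Qed.

Section ModFunctorPtrace.
Variables (k : fieldType) (C : pivCat k) (M N : rmodCat C).
Variable F : modFunctor M N.

(** Acting twice requires passing [F] through both actions; this composite is
    the vertical side shared by the squares of the associativity constraint and
    of [f \actm idm Y]. *)
Let mod_str2 (P : M) (X Y : C) :
    mor N (F ((P \act X) \act Y)) ((F P \act X) \act Y) :=
  (mod_str F P X \actm idm Y) \c mod_str F (P \act X) Y.

Lemma act_assoc_square (P : M) (X Y : C) :
  mod_str F P (X \ot Y) \c fmap F (act_assoc P X Y)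
    = act_assoc (F P) X Y \c mod_str2 P X Y.
Proof. by rewrite -mod_str_assoc -comp_assoc. Qed.

Lemma act_unit_square (P : M) :
  idm (F P) \c fmap F (act_unit P) = act_unit (F P) \c mod_str F P unit_ob.
Proof. by rewrite comp_idl mod_str_unit. Qed.

Lemma idm_actm_square (P : M) (X Y : C) (h : mor C X Y) :
  mod_str F P Y \c fmap F (idm P \actm h)
    = (idm (F P) \actm h) \c mod_str F P X.
Proof. by rewrite mod_str_nat fmap_id. Qed.

(** Naturality of the module structure moves [f] inside the first action, where
    acting on the square of the conjugate replaces it by the conjugate. *)
Lemma actm_idm_square (P : M) (X Y : C) (f : mor M (P \act X) (P \act X)) :
  mod_str2 P X Y \c fmap F (f \actm idm Y)
    = (iso_conj (mod_str F P X) (fmap F f) \actm idm Y) \c mod_str2 P X Y.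
Proof.
rewrite /mod_str2 -comp_assoc mod_str_nat !comp_assoc -!bmap_comp.
by rewrite iso_conj_square.
Qed.

Lemma fmap_ptrace (P : M) (V : C) (f : mor M (P \act V) (P \act V)) :
  fmap F (ptrace f) = ptrace (iso_conj (mod_str F P V) (fmap F f)).
Proof.
(* The inserted identities are the outermost vertical sides of the pasting. *)
rewrite -[LHS]comp_idl -[RHS]comp_idr /ptrace !fmap_comp.
apply: square_paste; last first.
  exact: (square_inv (i := fmap_iso F (act_unit P)) (act_unit_square P)).
apply: square_paste; last exact: idm_actm_square.
apply: square_paste; last first.
  exact: (square_inv (i := fmap_iso F (act_assoc P V _))
            (act_assoc_square P V _)).
apply: square_paste; last exact: actm_idm_square.
apply: square_paste; last exact: act_assoc_square.
apply: square_paste; last exact: idm_actm_square.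
exact: act_unit_square.
Qed.

End ModFunctorPtrace.

Theorem proposition2p7 (k : fieldType) (C : pivCat k) (M N : rmodCat C)
    (F : modFunctor M N) (tN : forall Q : N, mor N Q Q -> k)
    (htN : rmodTrace tN) :
  rmodTrace (fun (P : M) (f : mor M P P) => tN (F P) (fmap F f)).
Proof.
split=> [P a f g | P Q g f | P V f].
- by rewrite fmap_linear (rmodTrace_linear htN).
- by rewrite !fmap_comp (rmodTrace_cyclic htN).
- by rewrite fmap_ptrace -(rmodTrace_ptrace htN) (rmodTrace_conj htN).
Qed.
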